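(* For all $p\in(0,1)$, if $f\colon\{0,1\}^n\to\{0,1\}$ is $\varepsilon$-far from monotone with respect to $\mu_p^{\otimes n}$, then \[\mathbb{E}_{x\sim\mu_p^{\otimes n}}\left[\sqrt{s_f^-(x)}\right]\ge\Omega\left(\frac{\varepsilon}{\log(n/\varepsilon)^2}\right).\]
   Context: $\mu_p^{\otimes n}(x)=p^{|x|}(1-p)^{n-|x|}$. $\{0,1\}^n$ has the coordinatewise order; $f$ is monotone if $x\le y\Rightarrow f(x)\le f(y)$; $f$ is $\varepsilon$-far from monotone w.r.t. $\mu$ if $\min_{g\text{ monotone}}\mu(\{f\neq g\})\ge\varepsilon$. $s_f^-(x)$ is the number of coordinates $i$ such that, with $y$ equal to $x$ with coordinate $i$ flipped, either $x<y$ and $f(x)>f(y)$, or $x>y$ and $f(x)<f(y)$. The implied constant in $\Omega$ is absolute. *)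

(* Defs.v *)
From HB Require Import structures.
From mathcomp Require Import all_boot all_order all_algebra.
From mathcomp Require Import reals exp.
Set Implicit Arguments.
Unset Strict Implicit.
Unset Printing Implicit Defensive.
Import Order.TTheory GRing.Theory Num.Theory.
Local Open Scope ring_scope.

Notation cube n := {ffun 'I_n -> bool}.

Definition weight n (x : cube n) : nat := #|[set i | x i]|.

Definition cube_le n (x y : cube n) : bool := [forall i, (x i <= y i)%O].
Definition cube_lt n (x y : cube n) : bool := (x != y) && cube_le x y.

Definition flip n (x : cube n) (i : 'I_n) : cube n :=
  [ffun j => if j == i then ~~ x j else x j].

Definition monotone n (f : cube n -> bool) : bool :=
  [forall x, forall y, cube_le x y ==> (f x <= f y)%O].

(* s_f^-(x) *)
Definition neg_sens n (f : cube n -> bool) (x : cube n) : nat :=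
  #|[set i | (cube_lt x (flip x i) && (f x > f (flip x i))%O)
          || (cube_lt (flip x i) x && (f x < f (flip x i))%O)]|.

Definition mu (R : realType) n (p : R) (x : cube n) : R :=
  p ^+ weight x * (1 - p) ^+ (n - weight x).

Definition muset (R : realType) n (p : R) (A : {set cube n}) : R :=
  \sum_(x in A) mu p x.

Definition expect (R : realType) n (p : R) (F : cube n -> R) : R :=
  \sum_x mu p x * F x.

(* The default value 1 of the iterated minimum never matters when 0 <= p <= 1:
   the range is nonempty and all the terms are at most 1, see far_monotoneP. *)
Definition dist_monotone (R : realType) n (p : R) (f : cube n -> bool) : R :=
  \big[Num.min/1]_(g : {ffun cube n -> bool} | monotone g)
    muset p [set x | f x != g x].

Definition far_monotone (R : realType) n (p eps : R) (f : cube n -> bool) :=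
  eps <= dist_monotone p f.

Lemma mu_ge0 (R : realType) n (p : R) (x : cube n) :
  0 <= p <= 1 -> 0 <= mu p x.
Proof.
move=> /andP[p0 p1]; apply: mulr_ge0; apply: exprn_ge0 => //.
by rewrite subr_ge0.
Qed.

Lemma mu_prod (R : realType) n (p : R) (x : cube n) :
  mu p x = \prod_i (if x i then p else 1 - p).
Proof.
rewrite big_if /= !prodr_const /mu /weight; congr (_ ^+ _ * _ ^+ _).
  by apply: eq_card => i; rewrite !inE.
have cardC : (#|[set i | x i]| + #|~: [set i | x i]|)%N = n.
  by rewrite cardsC card_ord.
rewrite -[X in (X - _)%N]cardC addKn.
by apply: eq_card => i; rewrite !inE.
Qed.

Lemma sum_mu (R : realType) n (p : R) : \sum_(x : cube n) mu p x = 1.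
Proof.
under eq_bigr do rewrite mu_prod.
rewrite -(bigA_distr_bigA (fun (_ : 'I_n) (b : bool) => if b then p else 1 - p)).
by rewrite big1 // => i _; rewrite big_bool /= addrC subrK.
Qed.

Lemma muset_le1 (R : realType) n (p : R) (A : {set cube n}) :
  0 <= p <= 1 -> muset p A <= 1.
Proof.
move=> hp; rewrite -(sum_mu n p) [leRHS](bigID (mem A)) /= lerDl.
by apply: sumr_ge0 => x _; exact: mu_ge0.
Qed.

Lemma far_monotoneP (R : realType) n (p eps : R) (f : cube n -> bool) :
  0 <= p <= 1 ->
  far_monotone p eps f <->
  (forall g : cube n -> bool, monotone g ->
    eps <= muset p [set x | f x != g x]).
Proof.
move=> hp; rewrite /far_monotone; split=> [le_eps g mono_g|le_eps].
  have -> : [set x | f x != g x] = [set x | f x != [ffun x => g x] x].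
    by apply/setP => x; rewrite !inE ffunE.
  apply: le_trans le_eps _; apply: (bigmin_le_cond 1 (j := [ffun x => g x])).
  apply/forallP => x; apply/forallP => y; rewrite !ffunE.
  by move/forallP: mono_g => /(_ x)/forallP.
apply/bigmin_geP; split=> [|g mono_g]; last exact: le_eps.
apply: le_trans (muset_le1 [set x | f x != false] hp).
by apply: (le_eps (fun=> false)); apply/forallP => x; apply/forallP => y;
  rewrite lexx implybT.
Qed.

(* Main.v *)
Require Import Defs.
From HB Require Import structures.
From mathcomp Require Import all_boot all_order all_algebra.
From mathcomp Require Import reals exp.
From mathcomp Require Import ring lra.
Set Implicit Arguments.
Unset Strict Implicit.
Unset Printing Implicit Defensive.
Import Order.TTheory GRing.Theory Num.Theory.
Local Open Scope ring_scope.

(** Uniform measure.  For a set [S] of coordinates let [f_S] be [f] sorted along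
    the coordinates of [S] in a fixed order.  For fixed [S], the mean over [x] of
    [sqrt #{c : f_S x <> f_(S + c) x}], where [S + c] is [S] with the membership
    of [c] switched, is at most [E sqrt s_f^-]: each sort only rearranges these
    differences, and [sqrt] is submodular.  Applying the undirected Talagrand
    inequality to [S |-> f_S x] for each [x] then gives
    [E_S dist(f_S, f_(W \ S)) <= 2 E sqrt s_f^-] for a uniform subset [S] of any
    [W].  Sorting is a contraction, so [f_(W \ S)] is equally close to [f] sorted
    along [S] and then along [W \ S].  Starting from all the coordinates and
    halving [k] times, one reaches the empty set up to an error [n / 2 ^ k],
    whence [eps <= n / 2 ^ k + 2 k E sqrt s_f^-].

    Biased measure.  A bit of dyadic bias [q] is a chain of ANDs and ORs
    of [N] uniform bits.  Composing [f] with such chains multiplies [s_f^-]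
    by at most [N], and it preserves the distance to monotonicity up to a factor
    2, since by Harris' inequality the majority vote over the fibres of a
    monotone function is monotone.  As [f] is close to constant when [p] or
    [1 - p] is below [eps / n], [N = O(log (n / eps))] bits are precise enough. *)

(** * Flipping coordinates of a cube *)

Section Toggle.
Variable I : finType.
Implicit Types (x y z : {ffun I -> bool}) (c d : I).

Definition toggle x c : {ffun I -> bool} := [ffun d => (d == c) (+) x d].

Lemma toggle_eq x c : toggle x c c = ~~ x c.
Proof. by rewrite ffunE eqxx. Qed.

Lemma toggle_neq x c d : d != c -> toggle x c d = x d.
Proof. by rewrite ffunE => /negPf->. Qed.

Lemma toggleK c : involutive (toggle^~ c).
Proof. by move=> x; apply/ffunP => d; rewrite !ffunE addbA addbb. Qed.

Lemma toggleC x c d : toggle (toggle x c) d = toggle (toggle x d) c.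
Proof. by apply/ffunP => e; rewrite !ffunE addbCA. Qed.

(** Changes one at a time the coordinates where [x] and [y] differ. As [z c = x c] before each
    change, the direction of the change is known. *)
Lemma toggle_path (P : {ffun I -> bool} -> Prop) x y :
    P x ->
    (forall z c, z c = x c -> x c != y c -> P z -> P (toggle z c)) ->
  P y.
Proof.
move=> Px Ptoggle.
suff Ps (s : seq I) : P [ffun c => if c \in s then y c else x c].
  have -> // : y = [ffun c => if c \in enum I then y c else x c].
  by apply/ffunP => c; rewrite ffunE mem_enum.
elim: s => [|c s IHs].
  have -> // : [ffun c => if c \in [::] then y c else x c] = x.
  by apply/ffunP => c; rewrite ffunE.
have [/orP cs | /norP[cs xyc]] := boolP ((c \in s) || (x c == y c)).
  congr P: IHs; apply/ffunP => d; rewrite !ffunE inE.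
  case: eqP => [->|//] /=; case: ifP => // cNs.
  by case: cs => [|/eqP //]; rewrite cNs.
have -> : [ffun d => if d \in c :: s then y d else x d] =
          toggle [ffun d => if d \in s then y d else x d] c.
  apply/ffunP => d; rewrite !ffunE inE; case: eqP => [->|//] /=.
  by rewrite (negPf cs) /=; move: xyc; case: (x c); case: (y c).
by apply: Ptoggle => //; rewrite ffunE (negPf cs).
Qed.

Lemma toggle_invariant_const (T : Type) (F : {ffun I -> bool} -> T) :
  (forall x c, F (toggle x c) = F x) -> forall x y, F x = F y.
Proof.
move=> Ft x y; apply: (@toggle_path (fun z => F x = F z) x) => // z c _ _ ->.
by rewrite Ft.
Qed.

End Toggle.

(** * Averages over the cube and the undirected Talagrand inequality *)

Section Averages.
Variables (R : rcfType) (I : finType).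
Local Notation X := {ffun I -> bool}.
Implicit Types (x y b : X) (c d : I) (s : seq I) (F G : X -> R) (g : X -> bool).

Definition mean F : R := (\sum_x F x) / #|X|%:R.

Let cardX_gt0 : 0 < #|X|%:R :> R.
Proof. by rewrite ltr0n; apply/card_gt0P; exists [ffun=> true]. Qed.

Lemma eq_mean F G : F =1 G -> mean F = mean G.
Proof. by move=> FG; rewrite /mean; under eq_bigr do rewrite FG. Qed.

Lemma mean_const (a : R) : mean (fun=> a) = a.
Proof. by rewrite /mean sumr_const -[a *+ _]mulr_natr mulfK ?gt_eqF. Qed.

Lemma ler_mean F G : (forall x, F x <= G x) -> mean F <= mean G.
Proof.
by move=> FG; rewrite ler_pM2r ?invr_gt0 //; apply: ler_sum => x _; exact: FG.
Qed.

Lemma meanD F G : mean (fun x => F x + G x) = mean F + mean G.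
Proof. by rewrite /mean big_split mulrDl. Qed.

Lemma meanZ (a : R) F : mean (fun x => a * F x) = a * mean F.
Proof. by rewrite /mean -mulr_sumr mulrA. Qed.

Lemma mean_sum (J : finType) (F : J -> X -> R) :
  mean (fun x => \sum_j F j x) = \sum_j mean (F j).
Proof. by rewrite /mean exchange_big mulr_suml. Qed.

Lemma mean_exchange (F : X -> X -> R) :
  mean (fun x => mean (fun y => F x y)) = mean (fun y => mean (fun x => F x y)).
Proof.
rewrite /mean; congr (_ / _); rewrite -!mulr_suml; congr (_ / _).
exact: exchange_big.
Qed.

Lemma mean_bij (h : X -> X) F : bijective h -> mean (fun x => F (h x)) = mean F.
Proof.
by move=> hb; rewrite /mean [in RHS](reindex h) //=; apply: onW_bij.
Qed.

Lemma mean_toggle c F : mean (fun x => F (toggle x c)) = mean F.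
Proof. by apply: mean_bij; exact: inv_bij (toggleK c). Qed.

Lemma ler_mean_pair c F G :
    (forall x, x c = false -> F x + F (toggle x c) <= G x + G (toggle x c)) ->
  mean F <= mean G.
Proof.
move=> FG; suff: mean F + mean F <= mean G + mean G by lra.
rewrite -{2}(mean_toggle c F) -{2}(mean_toggle c G) -!meanD; apply: ler_mean => x.
have [xc|xc] := boolP (x c); last by apply: FG; exact: negPf.
have := FG (toggle x c); rewrite toggleK toggle_eq xc => /(_ erefl).
by rewrite addrC [leRHS]addrC.
Qed.

Lemma ler_mean_ex F (a : R) : mean F <= a -> exists x, F x <= a.
Proof.
move=> Fa; case: (boolP [exists x, F x <= a]) => [/existsP //|/existsPn aF].
suff : mean (fun=> a) < mean F by rewrite mean_const ltNge Fa.
rewrite ltr_pM2r ?invr_gt0 //; apply: ltr_sum => [|x _].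
  by apply/hasP; exists [ffun=> true] => //; rewrite mem_index_enum.
by rewrite ltNge aF.
Qed.

(** Conditional expectation: the coordinates in [s] are averaged out, the others are kept as in the
    argument. *)
Definition avgs s F : X -> R :=
  foldr (fun c (G : X -> R) x => (G x + G (toggle x c)) / 2) F s.

Lemma mean_avgs s F : mean (avgs s F) = mean F.
Proof.
elim: s => //= c s IHs.
rewrite (eq_mean (G := fun x => 2^-1 * (avgs s F x + avgs s F (toggle x c))));
  last by move=> x; rewrite mulrC.
by rewrite meanZ meanD mean_toggle IHs; lra.
Qed.

Lemma eq_avgs s F G x : F =1 G -> avgs s F x = avgs s G x.
Proof. by move=> FG; elim: s x => //= c s IHs x; rewrite !IHs. Qed.

Lemma ler_avgs s F G x : (forall y, F y <= G y) -> avgs s F x <= avgs s G x.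
Proof.
move=> FG; elim: s x => //= c s IHs x.
by have := IHs x; have := IHs (toggle x c); lra.
Qed.

Lemma avgs_const s (a : R) x : avgs s (fun=> a) x = a.
Proof. by elim: s x => //= c s IHs x; rewrite !IHs; lra. Qed.

Lemma avgsB s F G x : avgs s (fun y => F y - G y) x = avgs s F x - avgs s G x.
Proof. by elim: s x => //= c s IHs x; rewrite !IHs; lra. Qed.

Lemma avgsMl s F G x :
    (forall y c, c \in s -> G (toggle y c) = G y) ->
  avgs s (fun y => G y * F y) x = G x * avgs s F x.
Proof.
elim: s x => //= c s IHs x Ginv.
rewrite !IHs => [|y d ds|y d ds]; try by rewrite Ginv // inE ds orbT.
by rewrite Ginv ?mem_head //; ring.
Qed.

Lemma avgs_toggle s c F x :
  avgs s (fun y => F (toggle y c)) x = avgs s F (toggle x c).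
Proof. by elim: s x => //= d s IHs x; rewrite !IHs toggleC. Qed.

Lemma avgs_invariant s c F x : c \in s -> avgs s F (toggle x c) = avgs s F x.
Proof.
elim: s x => //= d s IHs x; rewrite inE => /predU1P[->|cs].
  by rewrite toggleK addrC.
by rewrite toggleC !IHs.
Qed.

Lemma avgs_enum F x : avgs (enum I) F x = mean F.
Proof.
rewrite -(mean_avgs (enum I)) -(mean_const (avgs (enum I) F x)).
apply: eq_mean => y; apply: toggle_invariant_const => z c.
by rewrite avgs_invariant // mem_enum.
Qed.

(** Convexity of the Euclidean norm of the vector [(F, G)], applied to one averaged coordinate at a
    time. *)
Lemma avgs_minkowski s F G x :
  Num.sqrt (avgs s F x ^+ 2 + avgs s G x ^+ 2) <=
    avgs s (fun y => Num.sqrt (F y ^+ 2 + G y ^+ 2)) x.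
Proof.
elim: s x => //= c s IHs x.
apply: le_trans (_ : _ <= (Num.sqrt (avgs s F x ^+ 2 + avgs s G x ^+ 2) +
  Num.sqrt (avgs s F (toggle x c) ^+ 2 + avgs s G (toggle x c) ^+ 2)) / 2) _;
  last by have := IHs x; have := IHs (toggle x c); lra.
move: (avgs s F x) (avgs s G x) (avgs s F (toggle x c)) (avgs s G (toggle x c)).
move=> a b a' b'.
have u0 : 0 <= a ^+ 2 + b ^+ 2 by rewrite addr_ge0 ?sqr_ge0.
have v0 : 0 <= a' ^+ 2 + b' ^+ 2 by rewrite addr_ge0 ?sqr_ge0.
rewrite -[leRHS]ger0_norm ?divr_ge0 ?addr_ge0 ?sqrtr_ge0 // -sqrtr_sqr.
apply: ler_wsqrtr; rewrite [leRHS]expr_div_n sqrrD !sqr_sqrtr // -sqrtrM //.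
(* After squaring, what remains is the Cauchy-Schwarz inequality in the plane. *)
suff : a * a' + b * b' <=
    Num.sqrt ((a ^+ 2 + b ^+ 2) * (a' ^+ 2 + b' ^+ 2)) by rewrite -mulr_natr; nra.
apply: le_trans (ler_norm _) _; rewrite -sqrtr_sqr; apply: ler_wsqrtr.
by have := sqr_ge0 (a * b' - b * a'); nra.
Qed.

(** Squaring the left side adds [u t^2 + t^4 / 4] to [u^2], at most [t^2 / 2 + t^2 / 4]. It is used
    with [u = 2 q (1 - q)], which is at most [1 / 2]. *)
Lemma sqrt_add_sqr_ge (u v t : R) :
  0 <= u <= 1 / 2 -> u <= v -> t ^+ 2 <= 1 ->
  u + t ^+ 2 / 2 <= Num.sqrt (v ^+ 2 + t ^+ 2).
Proof.
move=> /andP[u0 u1] uv t1; have t0 := sqr_ge0 t.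
rewrite -[leLHS]ger0_norm; last by nra.
rewrite -sqrtr_sqr; apply: ler_wsqrtr.
have : u ^+ 2 <= v ^+ 2 by rewrite lerXn2r ?nnegrE //; lra.
by move: (t ^+ 2) t0 t1 => w; rewrite !expr2; nra.
Qed.

(* Induction on coordinates: splitting off a coordinate, on whose two sides the
   means are [a] and [a'], adds [|a - a'|] in quadrature by Minkowski, which
   pays exactly for the convexity defect of [2 q (1 - q)]. *)
Lemma avgs_talagrand s g x (q := avgs s (fun y => (g y)%:R) x) :
  2 * q * (1 - q) <=
    avgs s (fun y => Num.sqrt (count (fun c => g y != g (toggle y c)) s)%:R) x.
Proof.
elim: s x @q => /= [|c s IHs] x.
  by rewrite sqrtr0; case: (g x); rewrite ?mulr1 ?mul0r ?subrr ?mulr0 ?mul0r.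
set a := avgs s _ x; set a' := avgs s _ (toggle x c).
have q01 z : 0 <= avgs s (fun y => (g y)%:R) z <= 1.
  rewrite -{1}(avgs_const s 0 z) -{3}(avgs_const s 1 z).
  by apply/andP; split; apply: ler_avgs => y; case: (g y); rewrite ?ler01 ?lexx.
(* The bound on one side of the cut along [c]; the hypothesis is symmetric in the two sides, so that
   it serves for both. *)
have key z : (avgs s (fun y => (g y)%:R) z - avgs s (fun y => (g y)%:R) (toggle z c)) ^+ 2
     = (a - a') ^+ 2 ->
   2 * avgs s (fun y => (g y)%:R) z * (1 - avgs s (fun y => (g y)%:R) z)
     + (a - a') ^+ 2 / 2 <=
   avgs s (fun y => Num.sqrt
     ((g y != g (toggle y c)) + count (fun d => g y != g (toggle y d)) s)%:R) z.
  move=> <-; set G := fun y => (g y != g (toggle y c))%:R : R.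
  set F := fun y => Num.sqrt (count (fun d => g y != g (toggle y d)) s)%:R : R.
  rewrite [leRHS](@eq_avgs _ _ (fun y => Num.sqrt (F y ^+ 2 + G y ^+ 2))); last first.
    move=> y; rewrite sqr_sqrtr ?ler0n // natrD addrC; congr (Num.sqrt (_ + _)).
    by rewrite /G; case: (_ != _); rewrite ?expr1n ?expr0n.
  apply: le_trans (avgs_minkowski _ _ _ _).
  have /andP[m0 m1] := q01 z; have /andP[n0 n1] := q01 (toggle z c).
  have Gge : (avgs s (fun y => (g y)%:R) z -
      avgs s (fun y => (g y)%:R) (toggle z c)) ^+ 2 <= avgs s G z ^+ 2.
    rewrite -avgs_toggle; set D := _ - _.
    have DG : D <= avgs s G z.
      rewrite /D -avgsB; apply: ler_avgs => y; rewrite /G.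
      by case: (g y); case: (g _) => /=; lra.
    have NDG : - D <= avgs s G z.
      rewrite /D opprB -avgsB; apply: ler_avgs => y; rewrite /G.
      by case: (g y); case: (g _) => /=; lra.
    by rewrite !expr2; nra.
  apply: le_trans (sqrt_add_sqr_ge _ (IHs z) _) _.
  - apply/andP; split; first by nra.
    by have := sqr_ge0 (avgs s (fun y => (g y)%:R) z - 1 / 2); nra.
  - by rewrite expr2; nra.
  by apply: ler_wsqrtr; rewrite lerD2l.
have := key x erefl; have := key (toggle x c); rewrite toggleK -/a -/a' -sqrrN opprB.
by move=> /(_ erefl) h1 h2; rewrite !expr2 in h1 h2; nra.
Qed.

Lemma talagrand g (q := mean (fun y => (g y)%:R)) :
  2 * q * (1 - q) <=
    mean (fun y => Num.sqrt #|[set c | g y != g (toggle y c)]|%:R).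
Proof.
rewrite /q -!(avgs_enum _ [ffun=> true]).
apply: le_trans (avgs_talagrand _ _ _) _; apply: ler_avgs => y.
rewrite -sum1_count big_enum_cond -sum1_card.
by under [X in _ <= Num.sqrt X%:R]eq_bigl do rewrite inE.
Qed.

(** Two values differ only if one is true and one is false, and the complement of [b] is uniform
    too. This gives [2 min(q, 1 - q)], which is at most [4 q (1 - q)]. *)
Lemma mean_neq_complement g (q := mean (fun y => (g y)%:R)) :
  mean (fun b => (g b != g [ffun c => ~~ b c])%:R) <= 4 * q * (1 - q).
Proof.
have cK : involutive (fun b : X => [ffun c => ~~ b c] : X).
  by move=> b; apply/ffunP => c; rewrite !ffunE negbK.
have qE : mean (fun b => (g [ffun c => ~~ b c])%:R) = q.
  exact: (mean_bij (fun b => (g b)%:R) (inv_bij cK)).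
have le1 : mean (fun b => (g b != g [ffun c => ~~ b c])%:R) <= q + q.
  rewrite -{2}qE -meanD; apply: ler_mean => b.
  by case: (g b); case: (g _) => /=; lra.
have le2 : mean (fun b => (g b != g [ffun c => ~~ b c])%:R) + (q + q) <= 2.
  rewrite -{2}qE -!meanD -[leRHS]mean_const; apply: ler_mean => b.
  by case: (g b); case: (g _) => /=; lra.
have q0 : 0 <= q.
  by rewrite -[0]mean_const; apply: ler_mean => b; rewrite ler0n.
have q1 : q <= 1.
  by rewrite -[1]mean_const; apply: ler_mean => b; rewrite lern1 leq_b1.
by have [qh|qh] := lerP q (1 / 2); nra.
Qed.

End Averages.

(** * Sorting along coordinates *)

Section Sorting.
Variable I : finType.
Local Notation X := {ffun I -> bool}.
Implicit Types (x y b : X) (c d : I) (s : seq I) (f g : X -> bool).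

Definition csort c f : X -> bool :=
  fun x => if x c then f x || f (toggle x c) else f x && f (toggle x c).

Definition csorts s f : X -> bool := foldl (fun h c => csort c h) f s.

Definition incr_at c f := forall x, x c = false -> f x -> f (toggle x c).

Lemma eq_csort c f g : f =1 g -> csort c f =1 csort c g.
Proof. by move=> fg x; rewrite /csort !fg. Qed.

Lemma eq_csorts s f g : f =1 g -> csorts s f =1 csorts s g.
Proof. by elim: s f g => //= c s IHs f g fg; apply/IHs/eq_csort. Qed.

Lemma csort_incr c f : incr_at c (csort c f).
Proof.
move=> x xc; rewrite /csort xc toggle_eq xc toggleK /=.
by case/andP=> _ ->.
Qed.

Lemma csort_id c f : incr_at c f -> csort c f =1 f.
Proof.
move=> fc x; rewrite /csort; have [xc|/negPf xc] := boolP (x c).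
  have := fc (toggle x c); rewrite toggle_eq xc toggleK => /(_ erefl).
  by case: (f x); case: (f _) => // ->.
by have := fc x xc; case: (f x); case: (f _) => // ->.
Qed.

(** On a face spanned by [c] and [d], the minimum and the maximum of two pairs ordered along [d] are
    again ordered along [d]. *)
Lemma csort_incr_at c d f : incr_at d f -> incr_at d (csort c f).
Proof.
have [-> _|dc fd x xd] := eqVneq c d; first exact: csort_incr.
rewrite /csort toggle_neq // (toggleC x d c).
have := fd x xd; have := fd (toggle x c); rewrite toggle_neq 1?eq_sym // xd.
move=> /(_ erefl).
by case: (x c); case: (f x); case: (f _); case: (f _); case: (f _) => // A B;
  try (by have := A isT); try (by have := B isT).
Qed.

Lemma csorts_incr_at s d f : incr_at d f -> incr_at d (csorts s f).
Proof. by elim: s f => //= c s IHs f fd; apply/IHs/csort_incr_at. Qed.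

Lemma csorts_incr s c f : c \in s -> incr_at c (csorts s f).
Proof.
elim: s f => //= d s IHs f; rewrite inE => /predU1P[->|cs]; last exact: IHs.
exact/csorts_incr_at/csort_incr.
Qed.

Lemma csorts_id s f : (forall c, c \in s -> incr_at c f) -> csorts s f =1 f.
Proof.
elim: s => //= c s IHs fs x.
rewrite (eq_csorts _ (csort_id (fs c (mem_head c s)))) IHs // => d ds.
by apply: fs; rewrite inE ds orbT.
Qed.

Lemma csorts_cat s t f : csorts (s ++ t) f = csorts t (csorts s f).
Proof. exact: foldl_cat. Qed.

(* On a two-dimensional face, a violation in direction [c] that survives
   sorting along [j] is still visible when the two sorts are exchanged. *)
Lemma csort_exchange c j f x : c != j ->
  csort j f x != csort c (csort j f) x ->
  csort j f x != csort j (csort c f) x.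
Proof.
move=> cj; rewrite /csort !toggle_neq 1?[j == c]eq_sym // !(toggleC x j c).
by case: (x c); case: (x j); case: (f x); case: (f _); case: (f _); case: (f _).
Qed.

End Sorting.

(** * Distances between functions under sorting *)

Section Tracker.
Variables (R : rcfType) (I : finType).
Local Notation X := {ffun I -> bool}.
Implicit Types (x y b : X) (c d j : I) (s : seq I) (f : X -> bool).
Implicit Types (g : I -> X -> bool).

Definition dist f f' : R := mean (fun x => (f x != f' x)%:R).

Lemma eq_dist f1 f2 f3 f4 : f1 =1 f2 -> f3 =1 f4 -> dist f1 f3 = dist f2 f4.
Proof. by move=> e1 e2; apply: eq_mean => x; rewrite e1 e2. Qed.

Lemma dist_triangle f1 f2 f3 : dist f1 f3 <= dist f1 f2 + dist f2 f3.
Proof.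
rewrite -meanD; apply: ler_mean => x; rewrite -natrD ler_nat.
by case: (f1 x); case: (f2 x); case: (f3 x).
Qed.

Lemma distC f1 f2 : dist f1 f2 = dist f2 f1.
Proof. by apply: eq_mean => x; rewrite eq_sym. Qed.

(** Sorting keeps the number of true values on each edge, and two sorted edges differ in only as
    many places as these numbers differ. *)
Lemma dist_csort c f1 f2 : dist (csort c f1) (csort c f2) <= dist f1 f2.
Proof.
apply: (ler_mean_pair (c := c)) => x xc; rewrite -!natrD ler_nat /csort.
rewrite toggle_eq xc toggleK /=.
by case: (f1 x); case: (f2 x); case: (f1 _); case: (f2 _).
Qed.

Lemma dist_csorts s f1 f2 : dist (csorts s f1) (csorts s f2) <= dist f1 f2.
Proof.
by elim: s f1 f2 => //= c s IHs f1 f2; apply: le_trans (IHs _ _) (dist_csort _ _ _).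
Qed.

(** * Difference sets along a sequence of sorts *)

Definition sqrt_card (A : {set I}) : R := Num.sqrt #|A|%:R.

Lemma sqrt_card_le (A B : {set I}) : A \subset B -> sqrt_card A <= sqrt_card B.
Proof. by move=> AB; apply: ler_wsqrtr; rewrite ler_nat subset_leq_card. Qed.

(** For the four roots, [u^2 + v^2 = a^2 + b^2] and [u] dominates [a] and [b]; hence [u v <= a b],
    and so [(u + v)^2 <= (a + b)^2]. *)
Lemma sqrt_card_submodular (A B : {set I}) :
  sqrt_card (A :|: B) + sqrt_card (A :&: B) <= sqrt_card A + sqrt_card B.
Proof.
have UI : (#|A :|: B|%:R + #|A :&: B|%:R = #|A|%:R + #|B|%:R :> R).
  by rewrite -!natrD cardsUI.
have leAU := sqrt_card_le (subsetUl A B).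
have leBU := sqrt_card_le (subsetUr A B).
have sq (C : {set I}) : sqrt_card C ^+ 2 = #|C|%:R by rewrite sqr_sqrtr ?ler0n.
have ge0 (C : {set I}) : 0 <= sqrt_card C by exact: sqrtr_ge0.
have u0 := ge0 (A :|: B); have v0 := ge0 (A :&: B); have a0 := ge0 A.
have b0 := ge0 B; move: UI; rewrite -!sq !expr2 => UI.
move: u0 v0 a0 b0 leAU leBU UI; move: (sqrt_card (A :|: B)) (sqrt_card (A :&: B)).
move: (sqrt_card A) (sqrt_card B) => a b u v u0 v0 a0 b0 au bu UI.
have uv_ab : u * v <= a * b.
  rewrite -ler_sqr ?nnegrE ?mulr_ge0 //.
  have -> : (u * v) ^+ 2 = u ^+ 2 * (a * a + b * b - u * u) by rewrite -UI; ring.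
  rewrite -subr_ge0; have -> : (a * b) ^+ 2 - u ^+ 2 * (a * a + b * b - u * u) =
    (u ^+ 2 - a ^+ 2) * (u ^+ 2 - b ^+ 2) by ring.
  by rewrite mulr_ge0 // subr_ge0 ler_sqr.
by rewrite -ler_sqr ?nnegrE ?addr_ge0 // !sqrrD !expr2 !mulr2n; lra.
Qed.

(** [g c] stands for the function obtained instead of [f] when the membership of [c] in the set of
    sorted coordinates is switched. *)
Definition diffs f g x : {set I} := [set c | f x != g c x].

(** The sides are compared on each edge in direction [j]. Where [f] is constant, the new difference
    sets lie in the union and the intersection of the old ones, and submodularity applies. Where [f]
    decreases they are swapped up to inclusion; where it increases they can only shrink. *)
Lemma sorting_step j f g g' :
    g j =1 csort j f -> g' j =1 f ->
    (forall c, c != j -> g' c =1 csort j (g c)) ->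
  mean (fun x => sqrt_card (diffs (csort j f) g' x)) <=
    mean (fun x => sqrt_card (diffs f g x)).
Proof.
move=> gj g'j g'E; apply: (ler_mean_pair (c := j)) => x xj.
set y := toggle x j; have yj : y j by rewrite toggle_eq xj.
have yK : toggle y j = x by rewrite toggleK.
have fx : csort j f x = f x && f y by rewrite /csort xj.
have fy : csort j f y = f y || f x by rewrite /csort yj yK.
have g'x c : c != j -> g' c x = g c x && g c y by move/g'E->; rewrite /csort xj.
have g'y c : c != j -> g' c y = g c y || g c x.
  by move/g'E->; rewrite /csort yj yK.
have sub (x1 x2 : X) : (forall c, c \in diffs (csort j f) g' x1 ->
    c \in diffs f g x2) ->
    sqrt_card (diffs (csort j f) g' x1) <= sqrt_card (diffs f g x2).
  by move=> h; apply: sqrt_card_le; apply/subsetP.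
case fxE : (f x); case fyE : (f y).
- apply: le_trans (sqrt_card_submodular _ _); apply: lerD; apply: sqrt_card_le;
    apply/subsetP => c; rewrite !inE ?fx ?fy fxE fyE /=;
    (have [->|cj] := eqVneq c j; first by rewrite g'j ?fxE ?fyE);
    by rewrite ?g'x ?g'y //; case: (g c x); case: (g c y).
- rewrite [leRHS]addrC; apply: lerD; apply: sub => c; rewrite !inE ?fx ?fy fxE fyE /=;
    (have [->|cj] := eqVneq c j; first by rewrite g'j gj ?fx ?fy fxE fyE);
    by rewrite ?g'x ?g'y //; case: (g c x); case: (g c y).
- apply: lerD; apply: sub => c; rewrite !inE ?fx ?fy fxE fyE /=;
    (have [->|cj] := eqVneq c j; first by rewrite g'j ?fxE ?fyE);
    by rewrite ?g'x ?g'y //; case: (g c x); case: (g c y).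
- rewrite addrC; apply: le_trans (sqrt_card_submodular _ _); apply: lerD;
    apply: sqrt_card_le;
    apply/subsetP => c; rewrite !inE ?fx ?fy fxE fyE /=;
    (have [->|cj] := eqVneq c j; first by rewrite g'j ?fxE ?fyE);
    by rewrite ?g'x ?g'y //; case: (g c x); case: (g c y).
Qed.

(** Induction on [s], deciding one coordinate [j] at a time. If [b j] is false, [g j] remains the
    sort of [f] along [j]; otherwise [f] and [g j] trade places. Coordinates already decided are
    carried along by [g], which is why [g] is general. *)
Lemma tracker_sensitivity s b f g :
    uniq s -> (forall c, c \in s -> g c =1 csort c f) ->
  mean (fun x => sqrt_card
    (diffs (csorts [seq d <- s | b d] f)
       (fun c => if c \in s then csorts [seq d <- s | toggle b c d] f
                 else csorts [seq d <- s | b d] (g c)) x)) <=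
  mean (fun x => sqrt_card (diffs f g x)).
Proof.
elim: s f g => [|j s IHs] f g /=; first by move=> _ _; exact: ler_mean.
move=> /andP[js us] gs.
have filt c : c \in s -> toggle b c j = b j.
  by move=> cs; apply: toggle_neq; apply: contraNneq js => ->.
have filtj : [seq d <- s | toggle b j d] = [seq d <- s | b d].
  by apply: eq_in_filter => d ds; apply: toggle_neq; apply: contraNneq js => <-.
case bj: (b j) => /=; last first.
  apply: le_trans (IHs f g us _) => [|c cs]; last by apply: gs; rewrite inE cs orbT.
  apply: ler_mean => x; apply: sqrt_card_le; apply/subsetP => c; rewrite !inE.
  have [->|cj] /= := eqVneq c j.
    rewrite (negPf js) toggle_eq bj filtj /=.
    by rewrite -(eq_csorts _ (gs j (mem_head _ _))).
  by case: ifP => // cs; rewrite filt // bj.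
(* Pending coordinates get the form [csort c (csort j f)] that the induction hypothesis requires;
   decided ones follow the sort along [j]. *)
pose g' c := if c == j then f else
  if c \in s then csort c (csort j f) else csort j (g c).
apply: le_trans (_ : _ <= mean (fun x => sqrt_card (diffs (csort j f) g' x))) _.
  apply: le_trans (IHs (csort j f) g' us _) => [|c cs x]; last first.
    rewrite /g' cs; case: eqP => // cj; by rewrite -cj cs in js.
  apply: ler_mean => x; apply: sqrt_card_le; apply/subsetP => c; rewrite !inE.
  rewrite /g'; have [->|cj] /= := eqVneq c j.
    by rewrite (negPf js) toggle_eq bj filtj.
  by case: ifP => // cs; rewrite filt // bj.
(* Exchanging the two sorts at the pending coordinates can only enlarge the difference sets, by
   [csort_exchange]. *)
pose g'' c := if c == j then f else csort j (g c).
apply: le_trans (_ : _ <= mean (fun x => sqrt_card (diffs (csort j f) g'' x))) _.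
  apply: ler_mean => x; apply: sqrt_card_le; apply/subsetP => c; rewrite !inE.
  rewrite /g' /g''; have [//|cj] := eqVneq c j; case: ifP => // cs.
  rewrite (eq_csort j (gs c _)) ?inE ?cs ?orbT //; exact: csort_exchange.
apply: sorting_step => [|//|c cj]; first exact: gs (mem_head _ _).
  by rewrite /g'' eqxx.
by rewrite /g'' (negPf cj).
Qed.

(** The directions of the decreasing edges at [x], whichever end [x] is: its cardinality is the
    negative sensitivity. *)
Definition violations f x : {set I} := [set c | f x != csort c f x].

(** For fixed [x], [mean_neq_complement] and [talagrand] apply to the sorted value as a function of
    the selection [b], with a factor 2 between them. Exchanging the means then leaves
    [tracker_sensitivity] for each fixed [b]. *)
Lemma dist_split_sorts s f : uniq s ->
  mean (fun b => dist (csorts [seq c <- s | ~~ b c] f) (csorts [seq c <- s | b c] f))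
    <= 2 * mean (fun x => sqrt_card (violations f x)).
Proof.
move=> us; pose t b x := csorts [seq c <- s | b c] f x.
rewrite (eq_mean (G := fun b => mean (fun x => (t b x != t [ffun c => ~~ b c] x)%:R)));
  last first.
  move=> b; apply: eq_mean => x; rewrite eq_sym /t.
  have -> // : [seq c <- s | [ffun c => ~~ b c] c] = [seq c <- s | ~~ b c].
  by apply: eq_filter => c; rewrite ffunE.
rewrite mean_exchange -meanZ.
apply: le_trans (_ : _ <= mean (fun x => 2 * mean (fun b =>
    sqrt_card [set c | t b x != t (toggle b c) x]))) _.
  apply: ler_mean => x; apply: le_trans (mean_neq_complement R (fun b => t b x)) _.
  by have := talagrand R (fun b => t b x); rewrite /sqrt_card; lra.
rewrite !meanZ ler_pM2l ?ltr0n // mean_exchange.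
rewrite -[leRHS](mean_const I); apply: ler_mean => b.
apply: le_trans (tracker_sensitivity b (g := fun c => csort c f) us _) => //.
apply: ler_mean => x; apply: sqrt_card_le; apply/subsetP => c; rewrite !inE /t.
(* Switching a coordinate outside [s] leaves the selection unchanged. *)
case: ifP => // cs; set u := [seq d <- s | b d].
have -> // : [seq d <- s | toggle b c d] = u.
  by apply: eq_in_filter => d ds; apply: toggle_neq; apply: contraFneq cs => <-.
by rewrite eqxx.
Qed.

(** * Random sublists and repeated halving *)

Fixpoint thin k (G : seq I -> R) s : R :=
  if k is k'.+1 then mean (fun b => thin k' G [seq c <- s | b c]) else G s.

Lemma thin_le k (G H : seq I -> R) s :
  (forall t, G t <= H t) -> thin k G s <= thin k H s.
Proof. by move=> GH; elim: k s => //= k IHk s; apply: ler_mean => b. Qed.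

Lemma mean_size_filter s :
  mean (fun b => (size [seq c <- s | b c])%:R) = (size s)%:R / 2 :> R.
Proof.
elim: s => [|c s IHs] /=; first by rewrite mean_const mul0r.
have half : mean (fun b : X => (b c)%:R) = 1 / 2 :> R.
  have : mean (fun b : X => (b c)%:R) + mean (fun b : X => (b c)%:R) = 1 :> R.
    rewrite -{2}(mean_toggle c) -meanD -[RHS](mean_const I); apply: eq_mean => b.
    by rewrite toggle_eq; case: (b c); rewrite ?addr0 ?add0r.
  by lra.
rewrite (eq_mean (G := fun b => (b c)%:R + (size [seq c <- s | b c])%:R)).
  by rewrite meanD IHs half -natr1; lra.
by move=> b; rewrite -natrD; case: (b c).
Qed.

(** [thin k] keeps each entry independently with probability [2^-k], so the left side is an expected
    length. *)
Lemma thin_size k s : thin k (fun t => (size t)%:R) s = (size s)%:R / 2 ^+ k.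
Proof.
elim: k s => [|k IHk] s /=; first by rewrite expr0 divr1.
rewrite (eq_mean (G := fun b => 2 ^- k * (size [seq c <- s | b c])%:R)).
  by rewrite meanZ mean_size_filter exprS invfM; ring.
by move=> b; rewrite IHk mulrC.
Qed.

(* The set sorted first may be dropped: both sides are then sorted along the
   other set, where one of them is already sorted, and sorting contracts. *)
Lemma thin_split k s f : uniq s ->
  mean (fun b => thin k (fun t => dist f (csorts t f))
    ([seq c <- s | ~~ b c] ++ [seq c <- s | b c])) <=
  thin k.+1 (fun t => dist f (csorts t f)) s +
    2 * mean (fun x => sqrt_card (violations f x)).
Proof.
set psi := mean (fun x => sqrt_card _); elim: k s => [|k IHk] s us.
  rewrite /=; apply: le_trans (lerD (lexx _) (dist_split_sorts f us)).
  rewrite -meanD; apply: ler_mean => b.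
  apply: le_trans (dist_triangle _ (csorts [seq c <- s | b c] f) _) _.
  rewrite lerD2l csorts_cat distC.
  set s1 := [seq c <- s | b c]; set s0 := [seq c <- s | ~~ b c].
  rewrite -(eq_dist (f1 := csorts s1 (csorts s0 f)) (f3 := csorts s1 (csorts s1 f))
    (fun=> erefl)) ?dist_csorts // => x.
  by rewrite csorts_id // => c; apply: csorts_incr.
(* Restricting to a random sublist commutes with splitting, so the induction hypothesis applies to
   each restricted list. *)
rewrite /= mean_exchange.
apply: le_trans (_ : _ <= mean (fun w => thin k.+1 (fun t => dist f (csorts t f))
  [seq c <- s | w c] + 2 * psi)) _; last by rewrite meanD mean_const lexx.
apply: ler_mean => w; have := IHk [seq c <- s | w c] (filter_uniq _ us).
apply: le_trans; rewrite le_eqVlt (eq_mean (G := fun b => thin k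
  (fun t => dist f (csorts t f)) ([seq c <- [seq c <- s | w c] | ~~ b c] ++
     [seq c <- [seq c <- s | w c] | b c]))) ?eqxx //.
move=> b; rewrite filter_cat -!filter_predI; congr (thin _ _ (_ ++ _));
  by apply: eq_filter => c; rewrite /= andbC.
Qed.

(** Some [b] does no worse than the average. Splitting changes the order of the sorts, hence a
    permutation of [s]. *)
Lemma thin_step k s f : uniq s ->
  exists2 s', perm_eq s' s & thin k (fun t => dist f (csorts t f)) s' <=
    thin k.+1 (fun t => dist f (csorts t f)) s +
      2 * mean (fun x => sqrt_card (violations f x)).
Proof.
move=> us; have [b bP] := ler_mean_ex (thin_split k f us).
exists ([seq c <- s | ~~ b c] ++ [seq c <- s | b c]) => //.
by rewrite perm_catC perm_filterC.
Qed.

Lemma directed_talagrand_uniform (eps : R) k f :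
    (forall h, (forall c, incr_at c h) -> eps <= dist f h) ->
  eps <= #|I|%:R / 2 ^+ k +
    2 * k%:R * mean (fun x => sqrt_card (violations f x)).
Proof.
move=> far; set psi := mean _; set d := fun t => dist f (csorts t f).
suff [s ps dle] : exists2 s, perm_eq s (enum I) &
    d s <= thin k d (enum I) + 2 * k%:R * psi.
  apply: le_trans (far (csorts s f) _) _ => [c|].
    by apply: csorts_incr; rewrite (perm_mem ps) mem_enum.
  (* Sorting along a list moves [f] by at most the length of the list: by 0 if it is empty, by at
     most 1 otherwise. *)
  apply: le_trans dle _; rewrite lerD2r cardE -thin_size; apply: thin_le => t.
  rewrite /d /dist; case: t => [|c t].
    rewrite (eq_mean (G := fun=> 0)) ?mean_const ?ler0n // => x.
    by rewrite eqxx.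
  apply: le_trans (_ : _ <= 1) _; last by rewrite ler1n.
  by rewrite -[leRHS](mean_const I); apply: ler_mean => x; rewrite lern1 leq_b1.
(* Descending from level [k] to level 0, each level costs [2 * psi] and may permute the list. *)
suff H (j : nat) : (j <= k)%N -> exists2 s, perm_eq s (enum I) &
    thin (k - j) d s <= thin k d (enum I) + 2 * j%:R * psi.
  by have := H k (leqnn k); rewrite subnn.
elim: j => [|j IHj] jk; first by exists (enum I); rewrite ?subn0 ?mulr0 ?mul0r ?addr0.
have [s ps sle] := IHj (ltnW jk).
have us : uniq s by rewrite (perm_uniq ps) enum_uniq.
have [s' ps' sle'] := thin_step (k - j.+1) f us.
exists s'; first exact: perm_trans ps' ps.
apply: le_trans sle' _; rewrite -subSn // subSS -natr1.
by move: sle; rewrite -/d -/psi; lra.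
Qed.

End Tracker.

(** * Harris' inequality and AND-OR chains of bits *)

Section AndOr.
Variables (R : rcfType) (I : finType).
Local Notation X := {ffun I -> bool}.
Implicit Types (x y : X) (c d : I) (s : seq I) (F G : X -> R) (t : seq (bool * I)).

Definition nondecr F := forall x c, x c = false -> F x <= F (toggle x c).

Lemma avgs_nondecr s F : nondecr F -> nondecr (avgs s F).
Proof.
move=> Finc; elim: s => //= d s IHs x c xc.
have [->|dc] := eqVneq d c; first by rewrite toggleK addrC.
have := IHs x c xc; have := IHs (toggle x d) c.
by rewrite toggle_neq 1?eq_sym // (toggleC x c d) => /(_ xc); lra.
Qed.

(** Induction on [s]: the two halves combine by Chebyshev's inequality on two points, since both
    averages change in the same direction along [c]. *)
Lemma avgs_harris s F G x : nondecr F -> nondecr G ->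
  avgs s F x * avgs s G x <= avgs s (fun y => F y * G y) x.
Proof.
move=> Finc Ginc; elim: s x => //= c s IHs x.
have := IHs x; have := IHs (toggle x c).
have := avgs_nondecr s Finc; have := avgs_nondecr s Ginc => G1 F1.
suff : 0 <= (avgs s F (toggle x c) - avgs s F x) *
            (avgs s G (toggle x c) - avgs s G x) by nra.
have [xc|/negPf xc] := boolP (x c); last first.
  by rewrite mulr_ge0 // subr_ge0; [exact: F1 | exact: G1].
rewrite -mulrNN mulr_ge0 // opprB subr_ge0 -{2}(toggleK c x);
  [apply: F1 | apply: G1]; by rewrite toggle_eq xc.
Qed.

Definition andor t x : bool :=
  foldr (fun dc r => if dc.1 then x dc.2 && r else x dc.2 || r) false t.

(** The probability that the chain holds on independent uniform bits. An AND prepends the binary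
    digit 0, an OR the digit 1. *)
Definition andor_bias (ds : seq bool) : R :=
  foldr (fun (d : bool) q => if d then q / 2 else (1 + q) / 2) 0 ds.

Lemma andor_toggle t x c : c \notin unzip2 t -> andor t (toggle x c) = andor t x.
Proof.
elim: t => //= -[d e] t IHt /=; rewrite inE negb_or => /andP[ce ct].
by rewrite toggle_neq 1?eq_sym // IHt.
Qed.

Lemma andor_incr t c : incr_at c (andor t).
Proof.
move=> x xc; have up e : x e -> toggle x c e.
  by have [->|ec] := eqVneq e c; [rewrite xc | rewrite toggle_neq].
elim: t => //= -[[] e] t IHt /=; first by case/andP=> /up-> /IHt.
by case/orP => [/up->|/IHt->] //; rewrite orbT.
Qed.

Lemma avgs_andor ds s x : size ds = size s -> uniq s ->
  avgs s (fun y => (andor (zip ds s) y)%:R) x = andor_bias ds.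
Proof.
elim: ds s x => [|d ds IHds] [|c s] x //= [sz] /andP[cs us].
have inv y e : e \in s -> toggle y e c = y c.
  by move=> es; apply: toggle_neq; apply: contraNneq cs => ->.
set A := fun y => (andor (zip ds s) y)%:R : R.
(* Writing OR through complements turns both gates into products, from which the factor in [y c] can
   be pulled out. *)
have split y : (if d then y c && andor (zip ds s) y else y c || andor (zip ds s) y)%:R
    = if d then (y c)%:R * A y else 1 - (~~ y c)%:R * (1 - A y).
  by rewrite /A; case: d; case: (y c); case: (andor _ _) => /=; ring.
rewrite !(eq_avgs _ _ split) {split}; case: d.
  rewrite !avgsMl => [|y e es|y e es]; try by rewrite inv.
  by rewrite !IHds // toggle_eq; case: (x c) => /=; ring.
rewrite !(avgsB s (fun=> 1)) !avgsMl => [|y e es|y e es]; try by rewrite inv.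
by rewrite !(avgsB s (fun=> 1)) !avgs_const !IHds // toggle_eq; case: (x c) => /=; field.
Qed.

(** The gates are read off the first [N] binary digits of [p]. *)
Lemma andor_bias_dense N (p : R) : 0 <= p <= 1 ->
  exists2 ds, size ds = N & andor_bias ds <= p <= andor_bias ds + 2 ^- N.
Proof.
elim: N p => [|N IHN] p /andP[p0 p1].
  by exists [::] => //=; rewrite expr0 invr1 p0 add0r.
have half : 2 ^- N.+1 = 2 ^- N / 2 :> R by rewrite exprSr invfM.
have [ph|ph] := lerP p (1 / 2).
  have [|ds sz /andP[lo hi]] := IHN (2 * p); first by apply/andP; split; lra.
  by exists (true :: ds); rewrite /= ?sz // half; apply/andP; split; lra.
have [|ds sz /andP[lo hi]] := IHN (2 * p - 1); first by apply/andP; split; lra.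
by exists (false :: ds); rewrite /= ?sz // half; apply/andP; split; lra.
Qed.

End AndOr.

(** * Representing the biased measure by uniform bits *)

Section Embedding.
Variables (R : realType) (n N : nat) (ds : seq bool).
Hypothesis size_ds : size ds = N.
Local Notation J := ('I_n * 'I_N)%type.
Local Notation X := {ffun J -> bool}.
Local Notation q := (andor_bias R ds).
Implicit Types (x z : cube n) (y : X) (i k : 'I_n) (f : cube n -> bool).

Definition block i : seq J := [seq (i, j) | j <- enum 'I_N].

Definition emb y : cube n := [ffun i => andor (zip ds (block i)) y].

Lemma mem_block i (c : J) : (c \in block i) = (c.1 == i).
Proof.
apply/mapP/eqP => [[j _ ->] //|<-]; exists c.2; first by rewrite mem_enum.
by case: c.
Qed.

Lemma size_block i : size ds = size (block i).
Proof. by rewrite size_map size_enum_ord. Qed.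

Lemma emb_toggle y (c : J) k : k != c.1 -> emb (toggle y c) k = emb y k.
Proof.
move=> kc; rewrite !ffunE; apply: andor_toggle.
by rewrite unzip2_zip ?(size_block k) // mem_block eq_sym.
Qed.

Lemma emb_incr y (c : J) : y c = false -> emb y c.1 -> emb (toggle y c) c.1.
Proof. by move=> yc; rewrite !ffunE; exact: andor_incr. Qed.

Lemma avgs_emb i y : avgs (block i) (fun y => (emb y i)%:R) y = q.
Proof.
rewrite -(avgs_andor R y (size_block i)).
  by apply: eq_avgs => z; rewrite ffunE.
by rewrite map_inj_uniq ?enum_uniq // => j1 j2 [].
Qed.

(** The blocks are disjoint, so the coordinates of [emb] are independent; one block is averaged out
    at a time. *)
Lemma mean_emb_eq x : mean (fun y => (emb y == x)%:R) = mu q x.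
Proof.
rewrite mu_prod.
have -> : mean (fun y => (emb y == x)%:R) =
    mean (fun y => \prod_(i <- enum 'I_n) (emb y i == x i)%:R) :> R.
  apply: eq_mean => y; rewrite big_enum /=.
  have [/eqP->|] := boolP (emb y == x); first by rewrite big1 // => i _; rewrite eqxx.
  case: (pickP (fun i => emb y i != x i)) => [i yi _|eqyx].
    by rewrite (bigD1 i) //= (negPf yi) mul0r.
  by case/negP; apply/eqP/ffunP => i; apply/eqP; rewrite -[_ == _]negbK eqyx.
rewrite -[in RHS]big_enum /=.
elim: (enum 'I_n) (enum_uniq 'I_n) => [_|i r IHr /= /andP[ir ur]].
  rewrite big_nil -[RHS](mean_const J).
  by apply: eq_mean => y; rewrite big_nil.
rewrite big_cons -IHr // -meanZ -(mean_avgs (block i)); apply: eq_mean => y.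
under eq_avgs do rewrite big_cons mulrC.
rewrite avgsMl => [|w c]; last first.
  rewrite mem_block => /eqP ci; apply: eq_big_seq => k kr.
  by rewrite emb_toggle // ci; apply: contraNneq ir => <-.
rewrite mulrC; congr (_ * _); case: (x i).
  by under eq_avgs do rewrite eqb_id; rewrite avgs_emb.
rewrite (@eq_avgs _ _ _ _ (fun w => 1 - (emb w i)%:R)) => [|w].
  by rewrite (avgsB _ (fun=> 1)) avgs_const avgs_emb.
by rewrite eqbF_neg; case: (emb w i); rewrite ?subrr ?subr0.
Qed.

Lemma mean_emb (F : cube n -> R) : mean (fun y => F (emb y)) = expect q F.
Proof.
rewrite /expect (eq_mean (G := fun y => \sum_x F x * (emb y == x)%:R)) => [|y].
  by rewrite mean_sum; apply: eq_bigr => x _; rewrite meanZ mean_emb_eq mulrC.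
rewrite (bigD1 (emb y)) //= eqxx mulr1 big1 ?addr0 // => x.
by rewrite eq_sym => /negPf->; rewrite mulr0.
Qed.

Definition neg_set f x : {set 'I_n} :=
  [set i | if x i then ~~ f x && f (toggle x i) else f x && ~~ f (toggle x i)].

Lemma card_neg_set f x : #|neg_set f x| = neg_sens f x.
Proof.
apply: eq_card => i; rewrite !inE.
have -> : flip x i = toggle x i.
  by apply/ffunP => k; rewrite !ffunE; case: eqP.
have neq : toggle x i != x.
  by apply/eqP => /ffunP /(_ i); rewrite toggle_eq; case: (x i).
have le1 : cube_le x (toggle x i) = ~~ x i.
  apply/forallP/idP => [/(_ i)|xi k]; first by rewrite toggle_eq; case: (x i).
  by have [->|ki] := eqVneq k i; rewrite ?toggle_eq ?toggle_neq //; case: (x i) xi.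
have le2 : cube_le (toggle x i) x = x i.
  apply/forallP/idP => [/(_ i)|xi k]; first by rewrite toggle_eq; case: (x i).
  by have [->|ki] := eqVneq k i; rewrite ?toggle_eq ?toggle_neq //; case: (x i) xi.
rewrite /cube_lt neq eq_sym neq le1 le2 /=.
by case: (x i); case: (f x); case: (f _).
Qed.

(** Changing the bit [(i, j)] can change only coordinate [i] of [emb y], and in the same direction
    as the bit. A decreasing edge of the composite thus lies over a decreasing edge of [f]. *)
Lemma violations_emb f y :
  violations (f \o emb) y \subset setX (neg_set f (emb y)) [set: 'I_N].
Proof.
apply/subsetP => -[i j]; rewrite !inE andbT /csort /=; set c := (i, j).
have [eqy|neqy] := eqVneq (emb (toggle y c)) (emb y).
  by rewrite eqy orbb andbb if_same eqxx.
have neqi : emb (toggle y c) i != emb y i.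
  apply: contraNneq neqy => eqi; apply/eqP/ffunP => k.
  by have [->//|ki] := eqVneq k i; exact: emb_toggle.
have -> : toggle (emb y) i = emb (toggle y c).
  apply/ffunP => k; have [->|ki] := eqVneq k i; last first.
    by rewrite toggle_neq // emb_toggle.
  by rewrite toggle_eq; move: neqi; case: (emb y i); case: (emb _ i).
have up := emb_incr (y := y) (c := c); have down := emb_incr (y := toggle y c) (c := c).
move: up down neqi; rewrite toggle_eq toggleK /=.
case: (y c); case: (emb y i); case: (emb _ i) => //= up down _;
  try (by have := up erefl isT); try (by have := down erefl isT);
  by case: (f _); case: (f _).
Qed.

Lemma mean_sqrt_violations_emb f :
  mean (fun y => sqrt_card R (violations (f \o emb) y)) <=
    N%:R * expect q (fun x => Num.sqrt (neg_sens f x)%:R).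
Proof.
rewrite -mean_emb -meanZ; apply: ler_mean => y.
apply: le_trans (sqrt_card_le R (violations_emb f y)) _.
rewrite /sqrt_card cardsX cardsT card_ord card_neg_set mulnC natrM sqrtrM ?ler0n //.
apply: ler_wpM2r; first exact: sqrtr_ge0.
(* The square root of [N] is bounded by [N]; this still fits the exponent 2 of the logarithm. *)
rewrite -[leRHS]ger0_norm ?ler0n // -sqrtr_sqr; apply: ler_wsqrtr.
by rewrite -natrX ler_nat; case: (N) => // m; apply: leq_pmulr.
Qed.

(** * Rounding an increasing function of the bits to a monotone function on the cube *)

Section Rounding.
Variables (f : cube n -> bool) (h : X -> bool).
Hypotheses (q_lt1 : q < 1) (q_ge0 : 0 <= q) (h_incr : forall c, incr_at c h).

Let W x : R := mean (fun y => (emb y == x)%:R * (h y)%:R).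

(* Majority vote of [h] on the fibre of [emb] over [x]. *)
Definition round_emb x : bool := mu q x <= 2 * W x.

(** With the bits outside block [i] fixed, [emb y i] and [h] are both increasing in the bits of the
    block, hence positively correlated by Harris' inequality. *)
Lemma round_emb_weight z i : z i = false ->
  q * (W z + W (toggle z i)) <= W (toggle z i).
Proof.
(* [C] selects the union of the fibres over [z] and [toggle z i], and ignores block [i]. *)
move=> zi; pose C y : R := [forall k, (k != i) ==> (emb y k == z k)]%:R.
have fib y : (emb y == z)%:R = C y * (~~ emb y i)%:R :> R /\
             (emb y == toggle z i)%:R = C y * (emb y i)%:R :> R.
  rewrite /C -!natrM !mulnb; split; congr (nat_of_bool _)%:R.
    apply/eqP/andP => [->|[/forallP yz yi]].
      by rewrite zi; split=> //; apply/forallP => k; rewrite eqxx implybT.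
    apply/ffunP => k; have [->|ki] := eqVneq k i; first by rewrite zi (negPf yi).
    by apply/eqP; have := yz k; rewrite ki.
  apply/eqP/andP => [->|[/forallP yz yi]].
    rewrite toggle_eq zi; split=> //; apply/forallP => k; apply/implyP => ki.
    by rewrite toggle_neq.
  apply/ffunP => k; have [->|ki] := eqVneq k i; first by rewrite toggle_eq zi yi.
  by rewrite toggle_neq //; apply/eqP; have := yz k; rewrite ki.
have -> : W z + W (toggle z i) = mean (fun y => C y * (h y)%:R).
  rewrite -meanD; apply: eq_mean => y; have [-> ->] := fib y.
  by case: (emb y i) => /=; ring.
have -> : W (toggle z i) = mean (fun y => C y * ((emb y i)%:R * (h y)%:R)).
  by apply: eq_mean => y; have [_ ->] := fib y; rewrite mulrA.
rewrite -meanZ -(mean_avgs (block i)) -[leRHS](mean_avgs (block i)).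
apply: ler_mean => y.
have Cinv w c : c \in block i -> C (toggle w c) = C w.
  rewrite mem_block => /eqP ci; congr (nat_of_bool _)%:R; apply: eq_forallb => k.
  by case: eqP => //= /eqP ki; rewrite emb_toggle ?ci.
rewrite (@avgsMl _ _ _ _ (fun=> q)) // !(avgsMl _ _ Cinv) mulrCA; apply: ler_wpM2l.
  by rewrite ler0n.
rewrite -(avgs_emb i y); apply: avgs_harris => w c wc; rewrite ler_nat.
  have [ci|ci] := eqVneq i c.1; last by rewrite emb_toggle.
  by have := emb_incr wc; rewrite -ci; case: (emb w i) => // ->.
by have := h_incr wc; case: (h w) => // ->.
Qed.

Lemma round_emb_monotone : monotone round_emb.
Proof.
apply/forallP => x; apply/forallP => x'; apply/implyP => /forallP xx'.
suff: round_emb x -> round_emb x' by case: (round_emb x) => // ->.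
apply: (@toggle_path _ (fun z => round_emb x -> round_emb z) x) => // z i zi neq imp fx.
have {}zi : z i = false by rewrite zi; move: (xx' i) neq; case: (x i); case: (x' i).
have := round_emb_weight zi; have {imp fx} := imp fx; rewrite /round_emb.
(* The two fibres have masses in the ratio [1 - q] to [q], so [round_emb_weight] says that [h] is at
   least as frequent on the upper one. *)
have : q * mu q z = (1 - q) * mu q (toggle z i).
  rewrite !mu_prod (bigD1 i) //= [in RHS](bigD1 i) //= toggle_eq zi /= mulrCA.
  congr (_ * (_ * _)); apply: eq_bigr => k ki; by rewrite toggle_neq.
move: (mu q z) (mu q _) (W z) (W _) => a b u v ab au uv.
rewrite -(ler_pM2l (_ : 0 < 1 - q)) ?subr_gt0 // -ab.
by have := q_ge0; move: (q) au uv => r; nra.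
Qed.

(** Where [f x] differs from the majority vote, [h] differs from [f x] on at least half of the
    fibre. *)
Lemma round_emb_dist :
  muset q [set x | f x != round_emb x] <= 2 * dist R (f \o emb) h.
Proof.
have -> : dist R (f \o emb) h =
    \sum_x mean (fun y => (emb y == x)%:R * (f x != h y)%:R).
  rewrite -mean_sum; apply: eq_mean => y.
  rewrite (bigD1 (emb y)) //= eqxx mul1r big1 ?addr0 // => x.
  by rewrite eq_sym => /negPf->; rewrite mul0r.
rewrite mulr_sumr /muset [leRHS](bigID [in [set x | f x != round_emb x]]) /=.
rewrite -[leLHS]addr0; apply: lerD; last first.
  apply: sumr_ge0 => x _; rewrite mulr_ge0 // -[0](mean_const J).
  by apply: ler_mean => y; rewrite mulr_ge0.
apply: ler_sum => x; rewrite inE /round_emb; case fx: (f x) => /=.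
  case: lerP => // lt _.
  have : mean (fun y => (emb y == x)%:R * (true != h y)%:R) + W x = mu q x.
    rewrite -meanD -mean_emb_eq; apply: eq_mean => y.
    by case: (h y) => /=; ring.
  by lra.
case: lerP => // le _; apply: le_trans le _; rewrite ler_pM2l //.
by apply: ler_mean => y; case: (h y).
Qed.

End Rounding.
End Embedding.

(** * Comparing nearby biases *)

Lemma bernoulli_sub (R : realDomainType) (a : R) k :
  0 <= a <= 1 -> 1 - k%:R * a <= (1 - a) ^+ k.
Proof.
move=> /andP[a0 a1]; elim: k => [|k IHk]; first by rewrite mul0r subr0.
have : (1 - k%:R * a) * (1 - a) <= (1 - a) ^+ k * (1 - a).
  by rewrite ler_wpM2r // subr_ge0.
rewrite exprSr -natr1; apply: le_trans.
by have := ler0n R k; nra.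
Qed.

(** As [q <= p], one factor of [mu] can only fall and the other can only rise, each by a factor at
    most 2 because [n * a <= 1 / 2]; the two errors do not compound. *)
Lemma mu_perturb (R : realType) n (p q a : R) (x : cube n) :
    0 < p < 1 -> 0 <= a <= 1 -> n%:R * a <= 1 / 2 ->
    (1 - a) * p <= q -> q <= p -> 1 - q <= (1 - p) * (1 + a) ->
  mu p x / 2 <= mu q x <= 2 * mu p x.
Proof.
move=> /andP[p0 p1] /andP[a0 a1] na q_ge q_le q_le'.
set w := weight x; have wn : (w <= n)%N.
  by apply: leq_trans (max_card _) _; rewrite card_ord.
have kn k : (k <= n)%N -> 1 / 2 <= (1 - a) ^+ k.
  move=> kn; apply: le_trans (bernoulli_sub k _); last by rewrite a0.
  have : k%:R * a <= n%:R * a by rewrite ler_wpM2r // ler_nat.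
  by lra.
(* Since [(1 + a) * (1 - a) <= 1], this follows from [kn]. *)
have up k : (k <= n)%N -> (1 + a) ^+ k <= 2.
  move=> /kn le; have : (1 + a) ^+ k * (1 - a) ^+ k <= 1.
    by rewrite -exprMn exprn_ile1 //; nra.
  have : 0 <= (1 + a) ^+ k by rewrite exprn_ge0 //; lra.
  by nra.
have q0 : 0 <= q by nra.
have pw0 : 0 <= p ^+ w by rewrite exprn_ge0 // ltW.
have pn0 : 0 <= (1 - p) ^+ (n - w) by rewrite exprn_ge0 //; lra.
have qn0 : 0 <= (1 - q) ^+ (n - w) by rewrite exprn_ge0 //; lra.
rewrite /mu -/w; apply/andP; split.
  have h1 : (1 - p) ^+ (n - w) <= (1 - q) ^+ (n - w).
    by rewrite lerXn2r ?nnegrE //; lra.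
  have h2 : (1 - a) ^+ w * p ^+ w <= q ^+ w.
    by rewrite -exprMn lerXn2r ?nnegrE //; nra.
  have h3 : p ^+ w / 2 <= q ^+ w by have := kn w wn; nra.
  by rewrite mulrAC ler_pM // divr_ge0.
have h1 : q ^+ w <= p ^+ w by rewrite lerXn2r ?nnegrE //; lra.
have h2 : (1 - q) ^+ (n - w) <= 2 * (1 - p) ^+ (n - w).
  apply: le_trans (_ : _ <= (1 - p) ^+ (n - w) * (1 + a) ^+ (n - w)) _.
    by rewrite -exprMn lerXn2r ?nnegrE //; nra.
  by have := up (n - w)%N (leq_subr _ _); nra.
by rewrite mulrCA ler_pM // exprn_ge0.
Qed.

(** * Bounds on [eps] from the constant functions *)

Lemma far_monotone_le_half (R : realType) n (p eps : R) (f : cube n -> bool) :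
  0 < p < 1 -> far_monotone p eps f -> eps <= 1 / 2.
Proof.
move=> /andP[p0 p1] /far_monotoneP far.
have {far} far b : eps <= muset p [set x | f x != b].
  apply: far => /=; first by rewrite !ltW.
  by apply/forallP => x; apply/forallP => y; rewrite lexx implybT.
(* The sets where [f] differs from the two constants partition the cube. *)
have : muset p [set x | f x != true] + muset p [set x | f x != false] = 1.
  rewrite -(sum_mu n p) (bigID [in [set x | f x != true]]) /=; congr (_ + _).
  by apply: eq_bigl => x; rewrite !inE; case: (f x).
by have := far true; have := far false; lra.
Qed.

(** The constant [f z] is monotone and agrees with [f] at [z]. *)
Lemma far_monotone_le_mu (R : realType) n (p eps : R) (f : cube n -> bool)
    (z : cube n) :
  0 < p < 1 -> far_monotone p eps f -> eps <= 1 - mu p z.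
Proof.
move=> /andP[p0 p1] /far_monotoneP far.
have p01 : 0 <= p <= 1 by rewrite !ltW.
apply: le_trans (far p01 (fun=> f z) _) _.
  by apply/forallP => x; apply/forallP => y; rewrite lexx implybT.
rewrite lerBrDr -(sum_mu n p) [leRHS](bigD1 z) //= [leRHS]addrC lerD2r /muset.
rewrite [leRHS](bigID [in [set x | f x != f z]]) /=.
rewrite [X in X + _](eq_bigl [in [set x | f x != f z]]) ?lerDl.
  by apply: sumr_ge0 => x _; exact: mu_ge0.
by move=> x; rewrite !inE andb_idl //; apply: contraNneq => ->.
Qed.

(** With [z] all false or all true, Bernoulli's inequality bounds [mu p z] below by [1 - n p] or
    [1 - n (1 - p)]. *)
Lemma far_monotone_bias (R : realType) n (p eps : R) (f : cube n -> bool) :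
  0 < p < 1 -> far_monotone p eps f ->
  eps <= n%:R * p /\ eps <= n%:R * (1 - p).
Proof.
move=> p01 far; have /andP[p0 p1] := p01.
have p01' : 0 <= p <= 1 by rewrite !ltW.
have q01 : 0 <= 1 - p <= 1 by apply/andP; split; lra.
split.
  have := far_monotone_le_mu [ffun=> false] p01 far.
  rewrite mu_prod; under eq_bigr do rewrite ffunE; rewrite prodr_const card_ord.
  by have := bernoulli_sub n p01'; lra.
have := far_monotone_le_mu [ffun=> true] p01 far.
rewrite mu_prod; under eq_bigr do rewrite ffunE; rewrite prodr_const card_ord.
by have := bernoulli_sub n q01; rewrite subKr; lra.
Qed.

(** * Choice of parameters and conclusion *)

Lemma dyadic_log (R : realType) (t : R) : 2 <= t ->
  exists2 m, t <= 2 ^+ m & m%:R * ln 2 <= 2 * ln t.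
Proof.
move=> t2; have ex : exists m, t <= 2 ^+ m.
  exists (Num.bound t); apply: le_trans (ltW (archi_boundP _)) _; first by lra.
  by rewrite -natrX ler_nat ltnW // ltn_expl.
(* For the least [m], if positive, [2^(m-1) < t]; the missing [ln 2] is at most [ln t], hence the
   factor 2. *)
exists (ex_minn ex); case: ex_minnP => // -[|m] tm mmin.
  by rewrite mul0r mulr_ge0 // ln_ge0; lra.
have ltm : 2 ^+ m < t by rewrite ltNge; apply/negP => /mmin; rewrite ltnn.
have t0 : 0 < t by lra.
have : ln (2 ^+ m) <= ln t by rewrite ler_ln ?posrE ?exprn_gt0 // ltW.
rewrite lnXn // -[ln 2 *+ m]mulr_natl -natr1.
have : ln 2 <= ln t by rewrite ler_ln ?posrE.
by lra.
Qed.

(* The law of [emb] has bias [q] with [|p - q| <= 2 ^- (3 m) <= eps / (2 n ^ 2)];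
   as [p] and [1 - p] are at least [eps / n], this changes [mu] by a factor at
   most 2. *)
Lemma directed_talagrand_biased (R : realType) n m (p eps : R) (f : cube n -> bool) :
    0 < p < 1 -> 0 < eps -> far_monotone p eps f -> n%:R <= eps * 2 ^+ m ->
  eps <= 672 * m%:R ^+ 2 * expect p (fun x => Num.sqrt (neg_sens f x)%:R).
Proof.
move=> p01 eps0 far nm; have /andP[p0 p1] := p01.
have [np np'] := far_monotone_bias p01 far.
have eps_half := far_monotone_le_half p01 far.
have n0 : (0 < n)%N by case: (n) np => // ; rewrite mul0r; lra.
have n1 : 1 <= n%:R :> R by rewrite ler1n.
have T2 : 2 <= 2 ^+ m :> R by nra.
have m0 : (0 < m)%N by case: (m) T2 => //; rewrite expr0; lra.
set T : R := 2 ^+ m in nm T2.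
have T0 : 0 < T by lra.
have nT : n%:R <= T by nra.
have mT : m%:R <= T by rewrite /T -natrX ler_nat ltnW // ltn_expl.
have p01' : 0 <= p <= 1 by rewrite !ltW.
have [ds sz /andP[]] := andor_bias_dense (3 * m) p01'.
set q := andor_bias R ds; set d := 2 ^- (3 * m) => q_le q_ge.
have dT : d * T * T * T = 1.
  have -> : d * T * T * T = d * T ^+ 3 by ring.
  by rewrite /d mulnC exprM mulVf // !expf_neq0 // pnatr_eq0.
have d0 : 0 < d by rewrite invr_gt0 exprn_gt0.
(* Of the three factors [T] in [1 / d], one is used for [p >= 1 / T] and the other two bound [2] and
   [n]. *)
have pd : 2 * n%:R * d <= p.
  have pT : 1 <= p * T.
    have : n%:R * 1 <= n%:R * (p * T) by nra.
    by rewrite ler_pM2l //; lra.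
  have : d * T * T <= p by rewrite -(ler_pM2r T0) dT.
  by nra.
have pd' : 2 * n%:R * d <= 1 - p.
  have pT : 1 <= (1 - p) * T.
    have : n%:R * 1 <= n%:R * ((1 - p) * T) by nra.
    by rewrite ler_pM2l //; lra.
  have : d * T * T <= 1 - p by rewrite -(ler_pM2r T0) dT.
  by nra.
(* The largest relative error that [mu_perturb] admits: [n * a = 1 / 2]. *)
pose a : R := (2 * n%:R)^-1.
have na : 2 * n%:R * a = 1 by rewrite mulfV // mulf_neq0 //; lra.
have a0 : 0 < a by rewrite invr_gt0; lra.
have pa : d <= p * a.
  have : 2 * n%:R * d * a <= p * a by rewrite ler_pM2r.
  by nra.
have pa' : d <= (1 - p) * a.
  have : 2 * n%:R * d * a <= (1 - p) * a by rewrite ler_pM2r.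
  by nra.
have muq (x : cube n) : mu p x / 2 <= mu q x <= 2 * mu p x.
  by apply: (@mu_perturb R n p q a x) => //; [apply/andP; split; nra | nra ..].
have q0 : 0 <= q by nra.
have q1 : q < 1 by lra.
(* One factor 2 is lost to the change of measure, another to the majority vote. *)
have farU (h : {ffun 'I_n * 'I_(3 * m) -> bool} -> bool) :
    (forall c, incr_at c h) -> eps / 4 <= dist R (f \o emb ds) h.
  move=> hi; have mono := round_emb_monotone sz q1 q0 hi.
  have := round_emb_dist R sz f h.
  have : muset p [set x | f x != round_emb R ds h x] / 2 <=
         muset q [set x | f x != round_emb R ds h x].
    rewrite /muset mulr_suml; apply: ler_sum => x _.
    by case/andP: (muq x).
  have := (far_monotoneP eps f p01').1 far _ mono.
  by rewrite /q; lra.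
(* Here [2^(2 m + 5) = 32 T^2], while the [3 m n] bits number at most [3 eps T^2]; the error is thus
   at most [eps / 8], half of [eps / 4]. *)
have := directed_talagrand_uniform (2 * m + 5) farU.
set psi := mean _; set E := expect p _ => main.
have psi_le : psi <= (3 * m)%:R * (2 * E).
  apply: le_trans (mean_sqrt_violations_emb R sz f) _.
  apply: ler_wpM2l; first by rewrite ler0n.
  rewrite /E /expect mulr_sumr; apply: ler_sum => x _; rewrite mulrA.
  by apply: ler_wpM2r; [exact: sqrtr_ge0 | case/andP: (muq x)].
have E0 : 0 <= E.
  by apply: sumr_ge0 => x _; rewrite mulr_ge0 ?mu_ge0 ?sqrtr_ge0.
have small : #|{: 'I_n * 'I_(3 * m)}|%:R / 2 ^+ (2 * m + 5) <= eps / 8.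
  have -> : 2 ^+ (2 * m + 5) = 32 * T ^+ 2 :> R.
    by rewrite exprD mulnC exprM mulrC; congr (_ * _); ring.
  rewrite card_prod !card_ord ler_pdivrMr ?mulr_gt0 ?exprn_gt0 // !natrM.
  have : n%:R * m%:R <= (eps * T) * T by rewrite ler_pM.
  by rewrite expr2; nra.
have m1 : 1 <= m%:R :> R by rewrite ler1n.
have K7 : (2 * m + 5)%:R <= 7 * m%:R :> R by rewrite natrD natrM; lra.
(* The right side is [84 m^2 E]; compared with the remaining [eps / 8], it gives [672 = 8 * 84]. *)
have : 2 * (2 * m + 5)%:R * psi <= 2 * (7 * m%:R) * ((3 * m)%:R * (2 * E)).
  apply: ler_pM => //; first by rewrite mulr_ge0.
    by rewrite -[0](mean_const ('I_n * 'I_(3 * m))%type); apply: ler_mean => y;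
       exact: sqrtr_ge0.
  by rewrite ler_pM2l.
by move: main small; rewrite natrM !expr2; nra.
Qed.

Theorem theorem2p5 (R : realType) :
  exists2 c : R, 0 < c &
    forall (n : nat) (p eps : R) (f : cube n -> bool),
      0 < p < 1 -> 0 < eps -> far_monotone p eps f ->
      c * (eps / ln (n%:R / eps) ^+ 2)
        <= expect p (fun x => Num.sqrt (neg_sens f x)%:R).
Proof.
have ln2 : 0 < ln 2 :> R by rewrite ln_gt0 // ltr1n.
(* [2688 = 4 * 672], where 4 comes from squaring [m * ln 2 <= 2 * L] with [L = ln (n / eps)]. *)
exists (ln 2 ^+ 2 / 2688) => [|n p eps f p01 eps0 far].
  by rewrite divr_gt0 // exprn_gt0.
have half := far_monotone_le_half p01 far.
have n0 : (0 < n)%N.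
  case: (n) f far => // f /(far_monotone_bias p01) [].
  by rewrite mul0r; lra.
have n1 : 1 <= n%:R :> R by rewrite ler1n.
have t2 : 2 <= n%:R / eps by rewrite ler_pdivlMr //; lra.
have [m tm mln] := dyadic_log t2.
have := directed_talagrand_biased (m := m) p01 eps0 far.
rewrite mulrC -ler_pdivrMr // => /(_ tm).
have L0 : 0 < ln (n%:R / eps) by rewrite ln_gt0 //; lra.
set L := ln (n%:R / eps) in mln L0 *; set E := expect p _ => main.
have E0 : 0 <= E.
  apply: sumr_ge0 => x _; rewrite mulr_ge0 ?sqrtr_ge0 ?mu_ge0 //.
  by case/andP: p01 => *; rewrite !ltW.
have sq : (m%:R * ln 2) ^+ 2 <= (2 * L) ^+ 2.
  by apply: lerXn2r => //; rewrite nnegrE mulr_ge0 // ltW.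
rewrite mulrA ler_pdivrMr ?exprn_gt0 // mulrAC ler_pdivrMr //.
have : ln 2 ^+ 2 * eps <= ln 2 ^+ 2 * (672 * m%:R ^+ 2 * E).
  by rewrite ler_pM2l // exprn_gt0.
have : (m%:R * ln 2) ^+ 2 * E <= (2 * L) ^+ 2 * E by rewrite ler_wpM2r.
by rewrite !exprMn; lra.
Qed.
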